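(* Let $n\ge2$. The automorphism group of the $n$-ary Cantor algebra $\mathscr{T}_n$ is (isomorphic to) the Thompson group $G_{n,1}$.
   Context: An $n$-ary Cantor algebra is a structure $(X,\alpha_1,\dots,\alpha_n,\lambda)$, where the $\alpha_i$ are unary operations and $\lambda$ is an $n$-ary operation on $X$ (operations written to the right of their arguments), satisfying: (CA1) $(x\alpha_1,\dots,x\alpha_n)\lambda=x$ for all $x\in X$; (CA2) $(x_1,\dots,x_n)\lambda\alpha_i=x_i$ for all $x_1,\dots,x_n\in X$ and $1\le i\le n$. $A_n=\{a_1,\dots,a_n\}$, $n\geq 2$; $A_n^{*}$ is the free monoid, $A_n^{\omega}$ the Cantor space of right-infinite strings. A finite subset of $A_n^{*}$ is a prefix code if no element is a prefix of a different element; it is a maximal prefix code if moreover every string in $A_n^{*}$ is a prefix of, or has as a prefix, some element of it. $\mathscr{T}_n$ is the monoid (under composition) of all total maps $A_n^{\omega}\to A_n^{\omega}$ of the form $x_iw\mapsto y_iw$ ($1\le i\le m$, $w\in A_n^{\omega}$), where $X=\{x_1,\dots,x_m\}$ is a maximal prefix code and $y_1,\dots,y_m\in A_n^{*}$ are arbitrary strings (repetitions allowed). For $a\in A_n$ let $\rho_a:A_n^{\omega}\to aA_n^{\omega}$, $w\mapsto aw$, with inverse $\rho_a^{-1}$. The Cantor algebra operations on $\mathscr{T}_n$ are $(f)\alpha_i=f\rho_{a_i}$ and $(f_1,\dots,f_n)\lambda=f_1\rho_{a_1}^{-1}\cup\dots\cup f_n\rho_{a_n}^{-1}$ (composition with the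 right-hand factor applied first). The Thompson group $G_{n,1}$: a morphism $\theta:R_1\to R_2$ between right ideals of $A_n^{*}$ is a function with $\theta(rs)=\theta(r)s$. $D_n$ is the inverse monoid, under composition of partial functions, of all bijective morphisms between finitely generated right ideals of $A_n^{*}$ (including the empty function). A non-zero idempotent $e$ of $D_n$ is essential if $ef\neq0$ for every non-zero idempotent $f$; $D_n^{e}$ is the inverse submonoid of all $a\in D_n$ with $a^{-1}a$ and $aa^{-1}$ essential. $G_{n,1}=D_n^{e}/\sigma$, where $a\,\sigma\,b$ iff there is $c\in D_n^{e}$ with $c\le a,b$ in the natural partial order ($c\le a$ iff $c=ac^{-1}c$, i.e. $c$ is a restriction of $a$). *)

(* Defs.v *)
From HB Require Import structures.
From mathcomp Require Import all_boot.
From mathcomp Require Import boolp classical_sets functions.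

Set Implicit Arguments.
Unset Strict Implicit.
Unset Printing Implicit Defensive.

Local Open Scope classical_set_scope.
Local Open Scope group_scope.

(* A word of A_n^* is a [seq 'I_n], an infinite string of A_n^omega is a
   function [nat -> 'I_n]; the letter a_(i+1) is the ordinal i. *)
Definition word (n : nat) := seq 'I_n.
Definition omega (n : nat) := nat -> 'I_n.

Record cantorAlgebra (n : nat) := CantorAlgebra {
  ca_sort :> Type;
  ca_alpha : 'I_n -> ca_sort -> ca_sort;
  ca_lambda : ('I_n -> ca_sort) -> ca_sort;
  CA1 : forall x, ca_lambda (fun i => ca_alpha i x) = x;
  CA2 : forall (x : 'I_n -> ca_sort) i, ca_alpha i (ca_lambda x) = x i }.

Section Automorphisms.
Variables (n : nat) (X : cantorAlgebra n).

Record caut := CAut {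
  caut_fun :> X -> X;
  caut_bij : bijective caut_fun;
  cautA : forall i x, caut_fun (ca_alpha i x) = ca_alpha i (caut_fun x);
  cautL : forall x : 'I_n -> X,
    caut_fun (ca_lambda x) = ca_lambda (fun i => caut_fun (x i)) }.

Lemma caut_ext (f g : caut) : f =1 g -> f = g.
Proof.
case: f g => [f fb fa fl] [g gb ga gl] /= /funext fg.
by case: _ / fg gb ga gl => gb ga gl; congr CAut; apply: Prop_irrelevance.
Qed.

Program Definition caut1 := @CAut id _ _ _.
Next Obligation. by exists id. Qed.

Program Definition caut_mul (f g : caut) := @CAut (f \o g) _ _ _.
Next Obligation. exact: bij_comp (caut_bij f) (caut_bij g). Qed.
Next Obligation. by rewrite !cautA. Qed.
Next Obligation. by rewrite !cautL. Qed.

Definition caut_invfun (f : caut) : X -> X :=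
  s2val (cid2 (let: Bijective g fK gK := caut_bij f in ex_intro2 _ _ g fK gK)).

Lemma caut_invfunK (f : caut) : cancel f (caut_invfun f).
Proof. by rewrite /caut_invfun; case: cid2. Qed.

Lemma caut_funK (f : caut) : cancel (caut_invfun f) f.
Proof. by rewrite /caut_invfun; case: cid2. Qed.

Program Definition caut_inv (f : caut) := @CAut (caut_invfun f) _ _ _.
Next Obligation.
exact: Bijective (@caut_funK f) (@caut_invfunK f).
Qed.
Next Obligation.
by apply: (can_inj (@caut_invfunK f)); rewrite cautA !caut_funK.
Qed.
Next Obligation.
apply: (can_inj (@caut_invfunK f)); rewrite cautL !caut_funK.
by congr ca_lambda; apply/funext => i; rewrite caut_funK.
Qed.

HB.instance Definition _ := gen_eqMixin caut.
HB.instance Definition _ := gen_choiceMixin caut.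

Fact caut_mulA : associative caut_mul.
Proof. by move=> f g h; apply: caut_ext. Qed.
Fact caut_mul1 : left_id caut1 caut_mul.
Proof. by move=> f; apply: caut_ext. Qed.
Fact caut_1mul : right_id caut1 caut_mul.
Proof. by move=> f; apply: caut_ext. Qed.
Fact caut_mulV : left_inverse caut1 caut_inv caut_mul.
Proof. by move=> f; apply: caut_ext => x /=; rewrite caut_invfunK. Qed.
Fact caut_Vmul : right_inverse caut1 caut_inv caut_mul.
Proof. by move=> f; apply: caut_ext => x /=; rewrite caut_funK. Qed.

HB.instance Definition _ :=
  isGroup.Build caut caut_mulA caut_mul1 caut_1mul caut_mulV caut_Vmul.

End Automorphisms.

Section CantorT.
Variable n : nat.
Implicit Types (x y u w : word n) (v : omega n) (i : 'I_n).

Definition rho i v : omega n := fun k => if k is k'.+1 then v k' else i.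

(* The common left inverse of all the [rho i]: the partial map [rho_i^-1] is
   the restriction of [tail] to the strings with first letter [i]. *)
Definition tail v : omega n := fun k => v k.+1.

Definition catw x v : omega n := foldr rho v x.

Lemma rho_tail v : rho (v 0) (tail v) = v.
Proof. by apply/funext => -[]. Qed.

Lemma catw_cat x y v : catw (x ++ y) v = catw x (catw y v).
Proof. exact: foldr_cat. Qed.

(* [seq]s stand for the finite subsets of A_n^*. *)
Definition prefix_code (X : seq (word n)) : Prop :=
  {in X &, forall x y, prefix x y -> x = y}.

Definition maximal_prefix_code (X : seq (word n)) : Prop :=
  prefix_code X /\ forall w, exists2 x, x \in X & prefix w x || prefix x w.

Definition isT (f : omega n -> omega n) : Prop :=
  exists (X : seq (word n)) (y : word n -> word n),
    maximal_prefix_code X /\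
    forall x, x \in X -> forall v, f (catw x v) = catw (y x) v.

Record Tn := MkT { T_fun :> omega n -> omega n; TP : isT T_fun }.

Lemma T_ext (f g : Tn) : f =1 g -> f = g.
Proof.
case: f g => [f fP] [g gP] /= /funext fg.
by case: _ / fg gP => gP; congr MkT; apply: Prop_irrelevance.
Qed.

Lemma maximal_prefix_code1 : maximal_prefix_code [:: [::]].
Proof.
split=> [x y|w]; first by rewrite !inE => /eqP-> /eqP->.
by exists [::]; rewrite ?inE // orbC prefix0s.
Qed.

Fact alpha_subproof i (f : Tn) : isT (f \o rho i).
Proof.
case: f => f /= [X [y [[Xp Xm] fX]]].
have [X0|X0] := boolP ([::] \in X).
  exists [:: [::]], (fun=> y [::] ++ [:: i]).
  split=> [|x]; first exact: maximal_prefix_code1.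
  by rewrite inE => /eqP-> v; rewrite /= catw_cat -fX.
exists [seq behead x | x <- X & prefix [:: i] x], (fun x => y (i :: x)).
have memX x : (x \in [seq behead x | x <- X & prefix [:: i] x]) = (i :: x \in X).
  apply/mapP/idP => [[[|j z]]|ix].
  - by rewrite mem_filter.
  - by rewrite mem_filter /= prefix0s andbT => /andP[/eqP<- ?] ->.
  - by exists (i :: x); rewrite // mem_filter /= eqxx prefix0s.
split; last by move=> x; rewrite memX => xX v; apply: (fX _ xX).
split=> [x z|w].
  rewrite !memX => xX zX xz; suff [] : i :: x = i :: z by [].
  by apply: (Xp _ _ xX zX); rewrite prefix_cons eqxx.
have [[|j x] xX] := Xm (i :: w); first by rewrite xX in X0.
rewrite !prefix_cons [j == i]eq_sym -andb_orr => /andP[/eqP ij wx].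
by exists x => //; rewrite memX ij.
Qed.

Definition alpha i (f : Tn) : Tn := MkT (alpha_subproof i f).

Definition lambda_fun (f : 'I_n -> Tn) (v : omega n) : omega n :=
  f (v 0) (tail v).

Lemma lambda_fun_rho (f : 'I_n -> Tn) i v : lambda_fun f (rho i v) = f i v.
Proof. by []. Qed.

Fact lambda_subproof (f : 'I_n -> Tn) : isT (lambda_fun f).
Proof.
have [[i0]|n0] := pselect (inhabited 'I_n); last first.
  exists [:: [::]], id; split; first exact: maximal_prefix_code1.
  by move=> x _ v; case: n0; split; exact: v 0.
have /choice[X fX] i := TP (f i).
have {fX} /choice[y fX] := fX.
exists [seq i :: x | i <- enum 'I_n, x <- X i].
exists (fun x => if x is i :: x' then y i x' else [::]).
have memX i x : (i :: x \in [seq i :: x | i <- enum 'I_n, x <- X i])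
    = (x \in X i).
  apply/allpairsPdep/idP => [[j [z [_ zX [-> ->]]]]//|xX].
  by exists i, x; rewrite mem_enum.
have mem0 : [::] \in [seq i :: x | i <- enum 'I_n, x <- X i] = false.
  by apply/negP => /allpairsPdep[? [? []]].
split; last first.
  move=> [|i x]; rewrite ?mem0 // memX => xX v.
  by have [_ <-] := fX i.
split=> [[|i x] [|j z]|[|i w]]; rewrite ?mem0 ?memX //.
- move=> xX zX; rewrite prefix_cons => /andP[/eqP ij].
  rewrite -{}ij in zX *; have [[Xp _] _] := fX i.
  by move=> /(Xp _ _ xX zX) ->.
- have [[_ /(_ [::])[x xX _]] _] := fX i0.
  by exists (i0 :: x); rewrite ?memX ?prefix0s.
- have [[_ /(_ w)[x xX wx]] _] := fX i.
  by exists (i :: x); rewrite ?memX // !prefix_cons eqxx.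
Qed.

Definition lambda (f : 'I_n -> Tn) : Tn := MkT (lambda_subproof f).

Fact lambda_alpha (f : Tn) : lambda (fun i => alpha i f) = f.
Proof. by apply: T_ext => v /=; rewrite /lambda_fun /= rho_tail. Qed.

Fact alpha_lambda (f : 'I_n -> Tn) i : alpha i (lambda f) = f i.
Proof. exact: T_ext. Qed.

Definition cantorT : cantorAlgebra n :=
  CantorAlgebra lambda_alpha alpha_lambda.

End CantorT.

Section InverseMonoid.
Variable n : nat.
Implicit Types (x y z r s u w : word n) (R S : set (word n)).

Definition fg_right_ideal R : Prop :=
  exists F : seq (word n), R = [set u | exists2 x, x \in F & prefix x u].

Definition pdom (f : word n -> option (word n)) : set (word n) :=
  [set x | exists y, f x = Some y].

Definition pim (f : word n -> option (word n)) : set (word n) :=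
  [set y | exists x, f x = Some y].

(* A partial function is a bijective morphism from its domain onto its image,
   both of which must be finitely generated right ideals. *)
Definition isD (f : word n -> option (word n)) : Prop :=
  [/\ fg_right_ideal (pdom f),
      fg_right_ideal (pim f),
      forall r r' s, f r = Some r' -> f (r ++ s) = Some (r' ++ s)
    & forall r1 r2 y, f r1 = Some y -> f r2 = Some y -> r1 = r2].

Record Dn := MkD { D_fun :> word n -> option (word n); DP : isD D_fun }.
Implicit Types a b c e f : Dn.

HB.instance Definition _ := gen_eqMixin Dn.
HB.instance Definition _ := gen_choiceMixin Dn.

Lemma Dmorph a r r' s : a r = Some r' -> a (r ++ s) = Some (r' ++ s).
Proof. by case: (DP a) => _ _ + _; apply. Qed.

Lemma Dinj a r1 r2 y : a r1 = Some y -> a r2 = Some y -> r1 = r2.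
Proof. by case: (DP a) => _ _ _; apply. Qed.

Lemma D_ext a b : (forall x y, a x = Some y <-> b x = Some y) -> a = b.
Proof.
case: a b => [a aP] [b bP] /= ab; have {}ab : a = b.
  apply/funext => x; case E : (a x) => [y|]; first by apply/esym/ab.
  by case E' : (b x) => [z|//]; move/ab: E'; rewrite E.
by case: _ / ab bP => bP; congr MkD; apply: Prop_irrelevance.
Qed.

Lemma fg_right_idealI R S :
  fg_right_ideal R -> fg_right_ideal S -> fg_right_ideal (R `&` S).
Proof.
move=> [F ->] [G ->].
exists ([seq x <- F | has (fun y => prefix y x) G] ++
        [seq y <- G | has (fun x => prefix x y) F]).
apply/seteqP; split=> u /=; last first.
  move=> [x + xu]; rewrite mem_cat !mem_filter.
  by move=> /orP[] /andP[/hasP[y yG yx] xF]; split;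
    do ?[by exists x]; exists y => //; apply: prefix_trans xu.
move=> [[x xF xu] [y yG yu]]; case/orP: (leq_total (size x) (size y)) => xy.
  exists y => //; rewrite mem_cat !mem_filter yG andbT; apply/orP; right.
  apply/hasP; exists x => //; move: xu yu; rewrite !prefixE => /eqP xu /eqP <-.
  by rewrite take_takel // xu.
exists x => //; rewrite mem_cat !mem_filter xF andbT; apply/orP; left.
apply/hasP; exists y => //; move: xu yu; rewrite !prefixE => /eqP <- /eqP yu.
by rewrite take_takel // yu.
Qed.

Lemma fg_right_ideal_image a R : fg_right_ideal R ->
  fg_right_ideal [set y | exists2 x, R x & a x = Some y].
Proof.
have [domP _ _ _] := DP a => /fg_right_idealI/(_ domP)[F RF].
have {}RF u : (R u /\ pdom a u) <-> exists2 x, x \in F & prefix x u.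
  by rewrite -[_ /\ _]/((R `&` pdom a) u) RF.
exists (pmap a F); apply/seteqP; split=> y /= [x].
  move=> Rx ax; have [|x' x'F /prefixP[s xE]] := (RF x).1.
    by split=> //; exists y.
  have [|_ [y' ax']] := (RF x').2; first by exists x'; rewrite ?prefix_refl.
  exists y'; first by rewrite mem_pmap -ax' map_f.
  by move: ax; rewrite xE (Dmorph s ax') => -[<-]; rewrite prefix_prefix.
rewrite mem_pmap => /mapP[x' x'F ax'] /prefixP[s ->].
exists (x' ++ s); last by apply: Dmorph.
by apply: (proj1 ((RF _).2 _)); exists x'; rewrite ?prefix_prefix.
Qed.

Definition dinv_fun a y : option (word n) :=
  if pselect (exists x, a x = Some y) is left h then Some (projT1 (cid h))
  else None.

Lemma dinv_funP a x y : dinv_fun a y = Some x <-> a x = Some y.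
Proof.
rewrite /dinv_fun; case: pselect => [h|nh]; last first.
  by split=> // ax; case: nh; exists x.
case: cid => z /= az; split=> [[<-]//|ax].
by rewrite (Dinj az ax).
Qed.

Fact dinv_subproof a : isD (dinv_fun a).
Proof.
have [ad ai am ainj] := DP a; split.
- have -> // : pdom (dinv_fun a) = pim a.
  by apply/seteqP; split=> y [x /dinv_funP]; exists x => //; apply/dinv_funP.
- have -> // : pim (dinv_fun a) = pdom a.
  by apply/seteqP; split=> x [y /dinv_funP]; exists y => //; apply/dinv_funP.
- by move=> y x s /dinv_funP/(Dmorph s)/dinv_funP.
- by move=> y1 y2 x /dinv_funP + /dinv_funP => -> [].
Qed.

Definition dinv a : Dn := MkD (dinv_subproof a).

Lemma dinvP a x y : dinv a y = Some x <-> a x = Some y.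
Proof. exact: dinv_funP. Qed.

Lemma comp_funP a b x z : obind a (b x) = Some z <->
  exists2 y, b x = Some y & a y = Some z.
Proof.
case: (b x) => [y|] /=; split=> //; last by case.
  by exists y.
by move=> [_ [<-]].
Qed.

Fact dmul_subproof a b : isD (fun w => obind a (b w)).
Proof.
have [ad ai am ainj] := DP a; have [bd bi bm binj] := DP b; split.
- have -> : pdom (fun w => obind a (b w)) =
      [set x | exists2 y, pdom a y & dinv b y = Some x].
    apply/seteqP; split=> x /=.
      by move=> [z /comp_funP[y bx ay]]; exists y;
        [exists z | apply/dinvP].
    by move=> [y [z ay] /dinvP bx]; exists z; apply/comp_funP; exists y.
  exact: fg_right_ideal_image.
- have -> : pim (fun w => obind a (b w)) =
      [set z | exists2 y, pim b y & a y = Some z].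
    apply/seteqP; split=> z /=.
      by move=> [x /comp_funP[y bx ay]]; exists y => //; exists x.
    by move=> [y [x bx] ay]; exists x; apply/comp_funP; exists y.
  exact: fg_right_ideal_image.
- move=> x z s /comp_funP[y /(Dmorph s) bx /(Dmorph s) ay].
  by apply/comp_funP; exists (y ++ s).
- move=> x1 x2 z /comp_funP[y1 bx1 ay1] /comp_funP[y2 bx2 ay2].
  by rewrite (Dinj ay1 ay2) in bx1; apply: Dinj bx1 bx2.
Qed.

Definition dmul a b : Dn := MkD (dmul_subproof a b).

Lemma fg_right_ideal_prefix w : fg_right_ideal [set u | prefix w u].
Proof.
exists [:: w]; apply/seteqP; split=> u /=; first by exists w; rewrite ?inE.
by move=> [x]; rewrite inE => /eqP->.
Qed.

Fact didw_subproof w : isD (fun u => if prefix w u then Some u else None).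
Proof.
split.
- have -> : pdom (fun u => if prefix w u then Some u else None)
      = [set u | prefix w u].
    apply/seteqP; split=> u /=; first by move=> [y]; case: ifP.
    by move=> wu; exists u; rewrite wu.
  exact: fg_right_ideal_prefix.
- have -> : pim (fun u => if prefix w u then Some u else None)
      = [set u | prefix w u].
    apply/seteqP; split=> u /=; last by move=> wu; exists u; rewrite wu.
    by move=> [x]; case: ifP => // wx [<-].
  exact: fg_right_ideal_prefix.
- by move=> r r' s; case: ifP => // wr [<-]; rewrite prefix_catl.
- by move=> r1 r2 y; do 2 case: ifP => // _; move=> [->] [->].
Qed.

Definition didw w : Dn := MkD (didw_subproof w).

Lemma didwP w x y : didw w x = Some y <-> prefix w x /\ x = y.
Proof. by rewrite /=; case: (prefix w x); split=> // -[] // _ ->. Qed.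

Definition dident : Dn := didw [::].

Lemma didentE w : dident w = Some w.
Proof. by rewrite /= prefix0s. Qed.

Fact dzero_subproof : isD (fun=> None).
Proof. by split=> //; exists [::]; apply/seteqP; split=> u /= -[]. Qed.

Definition dzero : Dn := MkD dzero_subproof.

Lemma dmulP a b x z : dmul a b x = Some z <->
  exists2 y, b x = Some y & a y = Some z.
Proof. exact: comp_funP. Qed.

Fact dmulA : associative dmul.
Proof. by move=> a b c; apply: D_ext => x y /=; case: (c x). Qed.

Fact dmul1 : left_id dident dmul.
Proof. by move=> a; apply: D_ext => x y /=; case: (a x) => //= z; rewrite prefix0s. Qed.

Fact dinvK : involutive dinv.
Proof.
by move=> a; apply: D_ext => x y; split=> [/dinvP/dinvP|ax] //; apply/dinvP/dinvP.
Qed.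

Fact dinvM : {morph dinv : a b / dmul a b >-> dmul b a}.
Proof.
move=> a b; apply: D_ext => x z; split.
  by move=> /dinvP/dmulP[y bz ay]; apply/dmulP; exists y; apply/dinvP.
by move=> /dmulP[y /dinvP ay /dinvP bz]; apply/dinvP/dmulP; exists y.
Qed.

HB.instance Definition _ := isStarMonoid.Build Dn dmulA dmul1 dinvK dinvM.

Definition idempotent_elt e : Prop := e * e = e.

Definition essential e : Prop :=
  [/\ idempotent_elt e, e <> dzero
    & forall f, idempotent_elt f -> f <> dzero -> e * f <> dzero].

Definition dle c a : Prop := c = a * c^-1 * c.

Definition De_pred : {pred Dn} :=
  fun a => `[< essential (a^-1 * a) /\ essential (a * a^-1) >].

Lemma DmulP a b x z : (a * b) x = Some z <->
  exists2 y, b x = Some y & a y = Some z.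
Proof. exact: dmulP. Qed.

Lemma DinvP a x y : a^-1 y = Some x <-> a x = Some y.
Proof. exact: dinvP. Qed.

Lemma D_neq0P a : a <> dzero <-> exists x y, a x = Some y.
Proof.
split=> [a0|[x [y ax]] a0]; last by rewrite a0 in ax.
apply: contrapT => nh; apply: a0; apply: D_ext => x y; split=> // ax.
by case: nh; exists x, y.
Qed.

Lemma DVmulP a x y : (a^-1 * a) x = Some y <-> x = y /\ pdom a x.
Proof.
split=> [/DmulP[z ax /DinvP ay]|[<- [z ax]]].
  by split; [apply: Dinj ax ay | exists z].
by apply/DmulP; exists z => //; apply/DinvP.
Qed.

Lemma idem_fix f x y : idempotent_elt f -> f x = Some y -> x = y.
Proof.
move=> ff fx; have := fx; rewrite -{1}ff => /DmulP[z fz fzy].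
by rewrite fx in fz; case: fz fzy => <- fy; apply: Dinj fx fy.
Qed.

Definition dense_dom a : Prop := forall w, exists s, pdom a (w ++ s).

Lemma essentialVmulP a : essential (a^-1 * a) <-> dense_dom a.
Proof.
split=> [[_ _ ess] w|da].
  have /D_neq0P[x [y]] : (a^-1 * a) * didw w <> dzero.
    apply: ess; last by apply/D_neq0P; exists w, w; rewrite /= prefix_refl.
    apply: D_ext => x y; split=> [/DmulP[z /didwP[_ ->]] //|wxy].
    by apply/DmulP; exists y => //; have [wx xy] := (didwP _ _ _).1 wxy;
      subst y.
  move=> /DmulP[_ /didwP[/prefixP[s ->] <-] /DVmulP[_ ?]].
  by exists s.
split.
- apply: D_ext => x y; split=> [/DmulP[z] /DVmulP[-> _] //|xy].
  by apply/DmulP; exists y => //; move/DVmulP: xy => [<- ?]; apply/DVmulP.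
- have [s ds] := da [::]; apply/D_neq0P; exists s, s; exact/DVmulP.
- move=> f ff /D_neq0P[x [y fx]]; have xy := idem_fix ff fx; subst y.
  have [s ds] := da x; apply/D_neq0P; exists (x ++ s), (x ++ s).
  by apply/DmulP; exists (x ++ s); [apply: Dmorph | apply/DVmulP].
Qed.

Lemma De_predP a : a \in De_pred <-> dense_dom a /\ dense_dom a^-1.
Proof.
have -> : (a \in De_pred) = `[< essential (a^-1 * a) /\ essential (a * a^-1) >] by [].
rewrite -essentialVmulP -essentialVmulP invgK.
by split=> [/asboolP|?] //; apply/asboolP.
Qed.

Lemma dense_domM a b :
  dense_dom a -> dense_dom b -> dense_dom (a * b).
Proof.
move=> da db w; have [s [y bw]] := db w; have [t [z ay]] := da y.
exists (s ++ t), z; apply/DmulP; exists (y ++ t) => //.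
by rewrite catA; apply: Dmorph.
Qed.

Fact De_monoid_closed : monoid_closed De_pred.
Proof.
split=> [|a b /De_predP[da da'] /De_predP[db db']]; apply/De_predP.
  by rewrite invg1; split=> w; exists [::], (w ++ [::]); exact: didentE.
by rewrite invgM; split; apply: dense_domM.
Qed.

Lemma De_predV a : a \in De_pred -> a^-1 \in De_pred.
Proof. by move=> /De_predP[da da']; apply/De_predP; rewrite invgK. Qed.

Lemma dleP c a : dle c a <-> forall x y, c x = Some y -> a x = Some y.
Proof.
split=> [-> x y|ca].
  by rewrite -mulgA => /DmulP[z /DVmulP[-> _]].
apply: D_ext => x y; rewrite -mulgA; split=> [cx|].
  apply/DmulP; exists x; last exact: ca.
  by apply/DVmulP; split=> //; exists y.
move=> /DmulP[_ /DVmulP[<- [z cx]] ax].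
by rewrite cx -ax; apply/esym/ca.
Qed.

Lemma dleM c a c' a' : dle c a -> dle c' a' -> dle (c * c') (a * a').
Proof.
move=> /dleP ca /dleP ca'; apply/dleP => x z /DmulP[y cx cy].
by apply/DmulP; exists y; [apply: ca' | apply: ca].
Qed.

Lemma dleV c a : dle c a -> dle c^-1 a^-1.
Proof. by move=> /dleP ca; apply/dleP => x y /DinvP/ca/DinvP. Qed.

End InverseMonoid.

Section Thompson.
Variable n : nat.

Record Dne := MkDe { De_val :> Dn n; _ : De_val \in @De_pred n }.

HB.instance Definition _ := [isSub for De_val].
HB.instance Definition _ := [Choice of Dne by <:].
HB.instance Definition _ :=
  SubChoice_isSubMonoid.Build (Dn n) (@De_pred n) Dne (@De_monoid_closed n).

Definition De_inv (a : Dne) : Dne := MkDe (De_predV (valP a)).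

HB.instance Definition _ := hasInv.Build Dne De_inv.

Fact De_invK : involutive De_inv.
Proof. by move=> a; apply/val_inj/invgK. Qed.
Fact De_invM : {morph De_inv : a b / a * b >-> b * a}.
Proof. by move=> a b; apply/val_inj/invgM. Qed.

HB.instance Definition _ := Monoid_isStarMonoid.Build Dne De_invK De_invM.

Implicit Types a b c : Dne.

Definition sigma a b : Prop := exists c, dle c a /\ dle c b.

Lemma sigma_refl a : sigma a a.
Proof. by exists a; split; apply/dleP. Qed.

Lemma sigma_sym a b : sigma a b -> sigma b a.
Proof. by move=> [c [? ?]]; exists c. Qed.

Lemma sigma_trans b a b' : sigma a b -> sigma b b' -> sigma a b'.
Proof.
move=> [c [/dleP ca /dleP cb]] [d [/dleP db /dleP db']].
exists (c * (d^-1 * d)); split; apply/dleP => x y.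
  by move=> /DmulP[z /DVmulP[-> _]] /ca.
move=> /DmulP[_ /DVmulP[<- [y' dx]] /cb].
by rewrite (db _ _ dx) => -[<-]; apply: db'.
Qed.

Lemma sigmaM a a' b b' : sigma a a' -> sigma b b' -> sigma (a * b) (a' * b').
Proof.
by move=> [c [ca ca']] [d [db db']]; exists (c * d); split; apply: dleM.
Qed.

Lemma sigmaV a a' : sigma a a' -> sigma a^-1 a'^-1.
Proof. by move=> [c [ca ca']]; exists c^-1; split; apply: dleV. Qed.

Definition sigmab : rel Dne := fun a b => `[< sigma a b >].

Fact sigmab_refl : reflexive sigmab.
Proof. by move=> a; apply/asboolP/sigma_refl. Qed.
Fact sigmab_sym : symmetric sigmab.
Proof. by move=> a b; apply/asboolP/asboolP; apply: sigma_sym. Qed.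
Fact sigmab_trans : transitive sigmab.
Proof.
by move=> b a c /asboolP ab /asboolP bc; apply/asboolP/(sigma_trans ab bc).
Qed.

Canonical sigma_equiv := EquivRel sigmab sigmab_refl sigmab_sym sigmab_trans.

Local Open Scope quotient_scope.

Definition thompson : Type := {eq_quot sigma_equiv}.
HB.instance Definition _ := Choice.on thompson.
HB.instance Definition _ := EqQuotient.on thompson.

Lemma thompson_eqP a b : \pi_thompson a = \pi_thompson b <-> sigma a b.
Proof. by split=> [/eqmodP/asboolP|ab] //; apply/eqmodP/asboolP. Qed.

Definition thompson_mul := lift_op2 thompson (fun a b : Dne => a * b).
Definition thompson_inv := lift_op1 thompson (fun a : Dne => a^-1).
Definition thompson_one : thompson := \pi_thompson 1.

Lemma pi_mul a b :
  thompson_mul (\pi_thompson a) (\pi_thompson b) = \pi_thompson (a * b).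
Proof.
by unlock thompson_mul; apply/thompson_eqP/sigmaM; apply/thompson_eqP; rewrite reprK.
Qed.

Lemma pi_inv a : thompson_inv (\pi_thompson a) = \pi_thompson a^-1.
Proof.
by unlock thompson_inv; apply/thompson_eqP/sigmaV; apply/thompson_eqP; rewrite reprK.
Qed.

Lemma sigmaVmul a : sigma (a^-1 * a) 1.
Proof.
exists (a^-1 * a); split; apply/dleP => // x y /DVmulP[-> _].
exact: didentE.
Qed.

Fact thompson_mulA : associative thompson_mul.
Proof.
by elim/quotW => a; elim/quotW => b; elim/quotW => c; rewrite !pi_mul mulgA.
Qed.
Fact thompson_mul1 : left_id thompson_one thompson_mul.
Proof. by elim/quotW => a; rewrite pi_mul mul1g. Qed.
Fact thompson_1mul : right_id thompson_one thompson_mul.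
Proof. by elim/quotW => a; rewrite pi_mul mulg1. Qed.
Fact thompson_mulV : left_inverse thompson_one thompson_inv thompson_mul.
Proof.
by elim/quotW => a; rewrite pi_inv pi_mul; apply/thompson_eqP/sigmaVmul.
Qed.
Fact thompson_Vmul : right_inverse thompson_one thompson_inv thompson_mul.
Proof.
elim/quotW => a; rewrite pi_inv pi_mul; apply/thompson_eqP.
by have := sigmaVmul a^-1; rewrite invgK.
Qed.

HB.instance Definition _ := isGroup.Build thompson
  thompson_mulA thompson_mul1 thompson_1mul thompson_mulV thompson_Vmul.

End Thompson.

(* Main.v *)
Require Import Defs.
From HB Require Import structures.
From mathcomp Require Import all_boot.
From mathcomp Require Import boolp classical_sets.

(** As a Cantor algebra, [Tn] is generated by the identity map, so an
    automorphism [f] is post-composition with the unit [f id] of the monoid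
    [Tn].  A unit [u] yields the element of [Dne] sending [x] to [y] whenever
    [u] maps the cone [x A^omega] to [y A^omega] by changing the prefix.
    Conversely a dense finitely generated right ideal contains all
    sufficiently long words, so an element of [Dne] acts on infinite strings
    through their long prefixes; it is a restriction of the element attached to
    that action, hence sigma-equivalent to it. *)

Set Implicit Arguments.
Unset Strict Implicit.
Unset Printing Implicit Defensive.

(** * Cones, uniform length bounds and right ideals *)

Section Cones.
Variable n : nat.
Implicit Types (x y w : word n) (u v : omega n) (f g : omega n -> omega n).

Lemma catw_inj x y u v :
  size x = size y -> catw x u = catw y v -> x = y /\ u = v.
Proof.
elim: x y => [|i x IH] [|j y] //= [/IH {}IH] E.
have Et : catw x u = catw y v by apply/funext => k; have := congr1 (@^~ k.+1) E.
by have /= -> := congr1 (@^~ 0) E; have [-> ->] := IH Et.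
Qed.

Lemma catw_split N u : exists w v, size w = N /\ u = catw w v.
Proof.
elim: N u => [|N IH] u; first by exists [::], u.
have [w [v [<- E]]] := IH (tail u).
by exists (u 0 :: w), v; split=> //=; rewrite -[catw w v]E rho_tail.
Qed.

(** A nonempty word never acts trivially as a prefix: with two letters available, it moves the
    constant string on a letter other than its first. *)
Lemma eq_cone x y : 1 < n -> (forall v, catw x v = catw y v) -> x = y.
Proof.
move=> hn; have other (i : 'I_n) : exists j, j != i.
  case: (eqVneq i (Ordinal hn)) => [->|ni]; last by exists (Ordinal hn); rewrite eq_sym.
  by exists (Ordinal (ltnW hn)).
have no_nil i z : ~ forall v, v = catw (i :: z) v.
  move=> E; have [j /eqP ji] := other i.
  by have := congr1 (@^~ 0) (E (fun=> j)).
elim: x y => [|i x IH] [|j y] // E.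
- by case: (no_nil _ _ E).
- by case: (no_nil i x) => v; rewrite E.
- have /= -> := congr1 (@^~ 0) (E (fun=> i)).
  rewrite (IH y) // => v.
  by apply/funext => k; have := congr1 (@^~ k.+1) (E v).
Qed.

Definition maps_cone f x y := forall v, f (catw x v) = catw y v.

Lemma maps_cone_cat f x y w : maps_cone f x y -> maps_cone f (x ++ w) (y ++ w).
Proof. by move=> fx v; rewrite !catw_cat fx. Qed.

Lemma maps_cone_comp f g x y z :
  maps_cone g x y -> maps_cone f y z -> maps_cone (f \o g) x z.
Proof. by move=> gx fy v; rewrite /= gx fy. Qed.

Lemma maps_cone_can f g x y : cancel f g -> maps_cone f x y -> maps_cone g y x.
Proof. by move=> fK fx v; rewrite -fx fK. Qed.

Lemma maps_cone_fun f x y z : 1 < n ->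
  maps_cone f x y -> maps_cone f x z -> y = z.
Proof. by move=> hn fy fz; apply: eq_cone => // v; rewrite -fy. Qed.

Definition words N : seq (word n) := [seq val t | t <- enum {: N.-tuple 'I_n}].

Lemma mem_words N w : (w \in words N) = (size w == N).
Proof.
apply/mapP/eqP => [[t _ ->]|<-]; first exact: size_tuple.
by exists (in_tuple w); rewrite ?mem_enum.
Qed.

Lemma maximal_prefix_code_words N : 0 < n -> maximal_prefix_code (words N).
Proof.
move=> n0; split=> [x y|w].
  rewrite !mem_words prefixE => /eqP-> /eqP szy.
  by rewrite take_oversize ?szy // => /eqP.
(* Padding by a fixed letter gives a code word comparable with [w], however short [w] is. *)
have szw : size (take N (w ++ nseq N (Ordinal n0))) == N.
  by rewrite size_takel // size_cat size_nseq leq_addl.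
exists (take N (w ++ nseq N (Ordinal n0))).
  by rewrite mem_words.
case: (leqP N (size w)) => Nw.
  by rewrite takel_cat // orbC prefix_take.
by rewrite take_cat ltnNge ltnW //= prefix_prefix.
Qed.

(** Trades prefix codes for a length bound: a word at least as long as every code word extends one
    of them, and conversely the words of length [N] form a maximal prefix code. *)
Lemma isTP f : 0 < n -> Defs.isT f <->
  exists N, forall w, N <= size w -> exists y, maps_cone f w y.
Proof.
move=> n0; split=> [[X [y [[_ Xm] fX]]]|[N fN]].
  exists (\max_(x <- X) size x) => w szw.
  have [x xX] := Xm w; rewrite orbC => /orP[/prefixP[s ->]|wx].
    by exists (y x ++ s); apply/maps_cone_cat/fX.
  suff -> : w = x by exists (y x); apply: fX.
  have /prefixP[s xE] := wx; move: szw; rewrite xE.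
  have := @leq_bigmax_seq _ X predT size x xX erefl; rewrite xE size_cat.
  move=> le_sz /(leq_trans le_sz).
  by rewrite -{2}[size w]addn0 leq_add2l leqn0 => /nilP ->; rewrite cats0.
have /choice[y fy] w : exists y, N <= size w -> maps_cone f w y.
  by case: (leqP N (size w)) => [/fN[y ?]|_]; [exists y | exists [::]].
exists (words N), y; split; first exact: maximal_prefix_code_words.
by move=> w; rewrite mem_words => /eqP szw; apply: fy; rewrite szw.
Qed.

Lemma isT_comp f g : 0 < n -> Defs.isT f -> Defs.isT g -> Defs.isT (f \o g).
Proof.
move=> n0 /isTP-/(_ n0)[N fN] /isTP-/(_ n0)[M gM]; apply/isTP => //.
(* [g] rewrites only the first [M] letters; the other [N] or more survive, so the image is long
   enough for [f]. *)
exists (M + N) => w szw; rewrite -(cat_take_drop M w).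
have [|y gy] := gM (take M w).
  by rewrite size_takel // (leq_trans _ szw) ?leq_addr.
have [|z fz] := fN (y ++ drop M w).
  rewrite size_cat size_drop (leq_trans _ (leq_addl _ _)) //.
  by rewrite leq_subRL // (leq_trans _ szw) ?leq_addr.
by exists z; apply: maps_cone_comp fz; apply: maps_cone_cat.
Qed.

Fact isT_id : Defs.isT (@id (omega n)).
Proof.
by exists [:: [::]], id; split; first exact: maximal_prefix_code1.
Qed.

(** The members of [R] of length at most [N] generate it: a longer word has its prefix of length [N]
    in [R]. *)
Lemma fg_right_ideal_long (R : set (word n)) N :
  (forall x s, R x -> R (x ++ s)) -> (forall w, N <= size w -> R w) ->
  fg_right_ideal R.
Proof.
move=> RM RN.
exists [seq w <- flatten [seq words k | k <- iota 0 N.+1] | `[< R w >]].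
apply/seteqP; split=> w /=; last first.
  by move=> [x]; rewrite mem_filter => /andP[/asboolP Rx _] /prefixP[s ->]; apply: RM.
have short x : size x <= N -> x \in flatten [seq words k | k <- iota 0 N.+1].
  move=> szx; apply/flatten_mapP; exists (size x); last by rewrite mem_words.
  by rewrite mem_iota ltnS.
move=> Rw; case: (leqP (size w) N) => szw.
  by exists w; rewrite ?prefix_refl // mem_filter short // andbT; apply/asboolP.
have szt : size (take N w) = N by rewrite size_takel // ltnW.
exists (take N w); last exact: prefix_take.
by rewrite mem_filter short ?szt // andbT; apply/asboolP/RN; rewrite szt.
Qed.

Lemma dense_dom_long (a : Dn n) : dense_dom a ->
  exists N, forall w, N <= size w -> exists y, a w = Some y.
Proof.
have [[F domE] _ _ _] := DP a; move=> da.
exists (\max_(x <- F) size x) => w szw; have [s] := da w.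
rewrite -[exists y, _]/(pdom a w) domE /= => -[x xF xws]; exists x => //.
(* The generator [x] is no longer than [w], so as a prefix of [w ++ s] it is already a prefix of
   [w]. *)
have szx : size x <= size w.
  exact: leq_trans (@leq_bigmax_seq _ F predT size x xF erefl) szw.
by move: xws; rewrite !prefixE takel_cat.
Qed.

End Cones.

(** * From units of [Tn] to elements of [Dne] *)

Section Germs.
Variable n : nat.
Hypothesis hn : 1 < n.
Implicit Types (x y w : word n) (f g : omega n -> omega n).

Let n0 : 0 < n := ltnW hn.

(** Taking every cone on which [f] changes a prefix gives the largest such partial map; all others
    are restrictions of it. *)
Definition germ_fun f x : option (word n) :=
  if pselect (exists y, maps_cone f x y) is left h then Some (projT1 (cid h))
  else None.

Lemma germ_funP f x y : germ_fun f x = Some y <-> maps_cone f x y.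
Proof.
rewrite /germ_fun; case: pselect => [h|nh]; last first.
  by split=> // fx; case: nh; exists y.
case: cid => z /= fz; split=> [[<-]//|fy].
by rewrite (maps_cone_fun hn fz fy).
Qed.

Lemma germ_dom_long f : Defs.isT f ->
  exists N, forall w, N <= size w -> pdom (germ_fun f) w.
Proof.
move=> /(isTP _ n0)[N fN]; exists N => w /fN[y fy].
by exists y; apply/germ_funP.
Qed.

Lemma germ_fun_fg f : Defs.isT f -> fg_right_ideal (pdom (germ_fun f)).
Proof.
move=> /germ_dom_long[N]; apply: fg_right_ideal_long.
move=> x s [y /germ_funP fx]; exists (y ++ s).
exact/germ_funP/maps_cone_cat.
Qed.

Lemma germ_fun_dense f : Defs.isT f -> forall w, exists s, pdom (germ_fun f) (w ++ s).
Proof.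
move=> /germ_dom_long[N fN] w; exists (nseq N (Ordinal n0)); apply: fN.
by rewrite size_cat size_nseq leq_addl.
Qed.

Variables f g : Tn n.
Hypotheses (fK : cancel f g) (gK : cancel g f).

(** Turns questions on the image of one germ (finite generation, density, injectivity) into
    questions on the domain of the inverse germ. *)
Lemma germ_fun_can x y : germ_fun f x = Some y <-> germ_fun g y = Some x.
Proof.
by split=> /germ_funP fx; apply/germ_funP; apply: maps_cone_can fx.
Qed.

Fact germ_isD : isD (germ_fun f).
Proof.
split.
- exact/germ_fun_fg/TP.
- suff -> : pim (germ_fun f) = pdom (germ_fun g) by apply/germ_fun_fg/TP.
  by apply/seteqP; split=> y [x /germ_fun_can fx]; exists x.
- by move=> x y s /germ_funP fx; apply/germ_funP/maps_cone_cat.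
- by move=> x1 x2 y /germ_fun_can + /germ_fun_can => -> [].
Qed.

Fact germ_De : MkD germ_isD \in @De_pred n.
Proof.
apply/De_predP; split; first exact/germ_fun_dense/TP.
move=> w; have [s [x gx]] := germ_fun_dense (TP g) w.
by exists s, x; apply/DinvP/germ_fun_can.
Qed.

Definition germ : Dne n := MkDe germ_De.

Lemma germP x y : germ x = Some y <-> maps_cone f x y.
Proof. exact: germ_funP. Qed.

End Germs.

(** * From elements of [Dne] to maps of infinite strings *)

Section Realization.
Variable n : nat.
Hypothesis hn : 1 < n.
Implicit Types (a b : Dn n).

Lemma realize a : dense_dom a ->
  exists f : Tn n, forall x y, a x = Some y -> maps_cone f x y.
Proof.
move=> /dense_dom_long[N aN].
(* The value at [u] is read off its unique prefix of length [N], where [a] is defined. *)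
have /choice[f fP] (u : omega n) : exists v : omega n, forall w u' y,
    size w = N -> u = catw w u' -> a w = Some y -> v = catw y u'.
  have [w [u' [szw ->]]] := catw_split N u.
  have [|y aw] := aN w; first by rewrite szw.
  exists (catw y u') => w2 u2 y2 szw2 /catw_inj[|<- <-]; first by rewrite szw2.
  by rewrite aw => -[<-].
have fa x y : a x = Some y -> maps_cone f x y.
  move=> ax v; have [w [v' [szw ->]]] := catw_split N v.
  rewrite -!catw_cat.
  have szt : size (take N (x ++ w)) = N.
    by rewrite size_takel // size_cat szw leq_addl.
  (* [a] at [x ++ w] is computed from [x] and from the prefix of length [N]; the morphism law makes
     both agree, and [f] was built from the latter. *)
  have [|z az] := aN (take N (x ++ w)); first by rewrite szt.
  have := Dmorph (drop N (x ++ w)) az.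
  rewrite cat_take_drop (Dmorph w ax) => -[->].
  rewrite [RHS]catw_cat -{1}(cat_take_drop N (x ++ w)).
  by apply: fP az => //; rewrite catw_cat.
suff fT : Defs.isT f by exists (MkT fT).
apply/(isTP _ (ltnW hn)); exists N => w /aN[y aw].
by exists y; apply: fa.
Qed.

Lemma realize_unique a (f g : omega n -> omega n) : dense_dom a ->
  (forall x y, a x = Some y -> maps_cone f x y) ->
  (forall x y, a x = Some y -> maps_cone g x y) -> f = g.
Proof.
move=> /dense_dom_long[N aN] fa ga; apply/funext => u.
have [w [v [szw ->]]] := catw_split N u.
have [|y aw] := aN w; first by rewrite szw.
by rewrite (fa _ _ aw) (ga _ _ aw).
Qed.

Lemma realize_can a (f g : omega n -> omega n) : dense_dom a ->
  (forall x y, a x = Some y -> maps_cone f x y) ->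
  (forall x y, (a^-1)%g x = Some y -> maps_cone g x y) -> cancel f g.
Proof.
move=> da fa ga u; suff /(congr1 (@^~ u)) : g \o f = id by [].
(* Both [g \o f] and the identity realize the idempotent [a^-1 * a], whose domain is that of [a]. *)
apply: (realize_unique (a := (a^-1 * a)%g)).
- by move=> w; have [s as_] := da w; exists s, (w ++ s); apply/DVmulP.
- move=> x y /DmulP[z ax az]; apply: maps_cone_comp (fa _ _ ax) (ga _ _ az).
- by move=> x y /DVmulP[<- _].
Qed.

End Realization.

(** * Automorphisms as units, and the isomorphism *)

Section Automorphisms.
Variable n : nat.
Hypothesis hn : 1 < n.
Let n0 : 0 < n := ltnW hn.

Notation autT := (caut (cantorT n)).
Implicit Types (f g : autT).

Definition idT : cantorT n := MkT (@isT_id n).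

Definition alphas (x : word n) (t : cantorT n) : cantorT n :=
  foldl (fun t i => ca_alpha i t) t x.

Lemma alphasE x (t : cantorT n) v :
  (alphas x t : Tn n) v = (t : Tn n) (catw x v).
Proof. by elim: x t => //= i x IH t; rewrite IH. Qed.

Lemma caut_alphas f x t : f (alphas x t) = alphas x (f t).
Proof. by elim: x t => //= i x IH t; rewrite IH cautA. Qed.

Definition unit_of f : Tn n := f idT.

(* On each cone [x A^omega] of a table of [t], the map [t] agrees with an
   [alphas]-image of [idT]. *)
Lemma cautE f (t : cantorT n) v : (f t : Tn n) v = unit_of f ((t : Tn n) v).
Proof.
have /(isTP _ n0)[N tN] := TP t.
have [w [v' [szw ->]]] := catw_split N v.
have [|y ty] := tN w; first by rewrite szw.
rewrite ty -alphasE -caut_alphas -alphasE -caut_alphas; congr (T_fun (f _) _).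
by apply: T_ext => u; rewrite !alphasE ty.
Qed.

Lemma unit_of_inj : injective unit_of.
Proof.
by move=> f g fg; apply: caut_ext => t; apply: T_ext => v; rewrite (cautE f) (cautE g) fg.
Qed.

Lemma unit_ofM f g : T_fun (unit_of (f * g)%g) = unit_of f \o unit_of g.
Proof. by apply/funext => v; rewrite /= -cautE. Qed.

Lemma unit_ofK f : cancel (unit_of f) (unit_of (f^-1)%g).
Proof. by move=> v; rewrite -cautE /= /unit_of caut_invfunK. Qed.

Lemma unit_ofVK f : cancel (unit_of (f^-1)%g) (unit_of f).
Proof. by move=> v; rewrite -cautE /= /unit_of caut_funK. Qed.

(** Post-composition with [u] commutes with the Cantor operations, which act only on the source of a
    map. *)
Lemma unit_of_surj (u u' : Tn n) : cancel u u' -> cancel u' u ->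
  exists f, unit_of f = u.
Proof.
move=> uK u'K.
pose post (s : Tn n) (t : cantorT n) : cantorT n := MkT (isT_comp n0 (TP s) (TP t)).
have postK (s s' : Tn n) : cancel s s' -> cancel (post s) (post s').
  by move=> sK t; apply: T_ext => v; rewrite /= sK.
have postA i t : post u (ca_alpha i t) = ca_alpha i (post u t) by exact: T_ext.
have postL t : post u (ca_lambda t) = ca_lambda (fun i => post u (t i)).
  exact: T_ext.
exists (CAut (Bijective (postK _ _ uK) (postK _ _ u'K)) postA postL).
exact: T_ext.
Qed.

Definition caut_germ f : Dne n := germ hn (@unit_ofK f) (@unit_ofVK f).

Definition caut_thompson f : thompson n := (\pi_(thompson n) (caut_germ f))%qT.

Fact caut_thompsonM :
  {morph caut_thompson : f g / (f * g)%g >-> (f * g)%g}.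
Proof.
move=> f g; rewrite [RHS]pi_mul; apply/thompson_eqP/sigma_sym.
(* The composite may change prefixes on larger cones, so the product of germs is in general only a
   restriction of its germ. *)
exists (caut_germ f * caut_germ g)%g; split; apply/dleP => // x z.
move=> /DmulP[y /germP gx /germP fy]; apply/germP; rewrite unit_ofM.
exact: maps_cone_comp fy.
Qed.

HB.instance Definition _ :=
  isMultiplicative.Build autT (thompson n) caut_thompson caut_thompsonM.

Lemma caut_thompson_inj : injective caut_thompson.
Proof.
move=> f g /thompson_eqP[c [/dleP cf /dleP cg]].
(* The common restriction [c] still has dense domain, so it determines the map realizing it. *)
have [dc _] := (De_predP _).1 (valP c).
apply/unit_of_inj/T_ext => v; congr (_ v); apply: (realize_unique dc) => x y.
  by move/cf/germP.
by move/cg/germP.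
Qed.

Lemma caut_thompson_surj (q : thompson n) : exists f, caut_thompson f = q.
Proof.
elim/quotW: q => a; have [da dV] := (De_predP _).1 (valP a).
have [u ua] := realize hn da; have [u' ua'] := realize hn dV.
have uK := realize_can da ua ua'.
have u'K : cancel u' u by apply: realize_can dV ua' _; rewrite invgK.
have [f fu] := unit_of_surj uK u'K; exists f.
(* Since the germ is maximal, [a] itself is the common restriction. *)
apply/thompson_eqP; exists a; split; apply/dleP => // x y ax.
by apply/germP; rewrite fu; apply: ua.
Qed.

End Automorphisms.

Theorem theorem5p24 (n : nat) (hn : 1 < n) :
  exists phi : {multiplicative caut (cantorT n) -> thompson n}, bijective phi.
Proof.
exists (caut_thompson hn).
have /choice[g gK] := caut_thompson_surj hn.
exists g; last exact: gK.
by move=> f; apply: (caut_thompson_inj (hn := hn)); exact: gK.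
Qed.
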